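(* Let $p$ be a prime, let $n,k,l$ be positive integers with $l\mid k$, and put $d=\gcd(n,k)$, $e=\gcd(n,l)$, $L=\operatorname{lcm}(d,l)$. Then $$\{x\in \mathbb{F}_{p^n}\mid T_l^k(x)=0\}=\begin{cases}\mathbb{F}_{p^d}, & \text{if } p\mid \frac{k}{L},\\ S_e^{2e}(\mathbb{F}_{p^d}), & \text{otherwise.}\end{cases}$$ Consequently, $$\#\{x\in \mathbb{F}_{p^n}\mid T_l^k(x)=0\}=\begin{cases}p^{d}, & \text{if } p\mid \frac{k}{L},\\ p^{d-e}, & \text{otherwise.}\end{cases}$$
   Context: For positive integers $u\mid v$ and a prime $p$, define the linearized polynomials $T_u^v(X)=\sum_{i=0}^{v/u-1}X^{p^{ui}}$ and $S_u^v(X)=\sum_{i=0}^{v/u-1}(-1)^iX^{p^{ui}}$; in particular $S_u^{2u}(X)=X-X^{p^u}$. All finite fields $\mathbb{F}_{p^m}$ are regarded as subfields of a fixed algebraic closure $\overline{\mathbb{F}_p}$. For a polynomial $F$ and a set $A$, $F(A)=\{F(x)\mid x\in A\}$. Since $d\mid k$ and $l\mid k$, $L$ divides $k$, and $e\mid d$. *)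

(* Defs.v *)
From mathcomp Require Import all_boot all_order all_algebra.
From mathcomp Require Export mathcomp_extra boolp classical_sets functions cardinality.

Set Implicit Arguments.
Unset Strict Implicit.
Unset Printing Implicit Defensive.

Import GRing.Theory.
Local Open Scope classical_set_scope.
Local Open Scope card_scope.
Local Open Scope ring_scope.

(* [K], with the structural map [iota] from [F], is an algebraic closure of
   [F]: the closedness of [K] is carried by its type. *)
Definition is_algebraic_closure (F : fieldType) (K : closedFieldType)
    (iota : {rmorphism F -> K}) : Prop :=
  forall x : K, algebraicOver iota x.

Definition is_subfield_of_order (K : fieldType) (q : nat) (E : set K) : Prop :=
  divring_closed (mem E) /\ E #= `I_q.

(* The finite field with [q] elements inside [K]. A field has at most one
   subfield of order [q], so the union below has at most one member; when [K] is
   an algebraic closure of 'F_p and [q] is a positive power of the prime [p], it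
   has exactly one. *)
Definition GF (K : fieldType) (q : nat) : set K :=
  \bigcup_(E in [set E : set K | is_subfield_of_order q E]) E.
Arguments GF : clear implicits.

Definition T_poly (R : nzRingType) (p u v : nat) : {poly R} :=
  \sum_(i < v %/ u) 'X^(p ^ (u * i)).
Arguments T_poly : clear implicits.

Definition S_poly (R : nzRingType) (p u v : nat) : {poly R} :=
  \sum_(i < v %/ u) (-1) ^+ i *: 'X^(p ^ (u * i)).
Arguments S_poly : clear implicits.

(* Main.v *)
(* If T_l^k(x) = 0 then x - x^(p^k) = T_l^k(x - x^(p^l)) = 0, so the zeros in
   F_(p^n) lie in F_(p^d). There x^(p^(l i)) only depends on i modulo
   d/e = L/l, and since l/e is coprime to d/e the exponents l i run through
   the multiples of e modulo d; hence T_l^k = (k/L) T_e^d on F_(p^d).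
   If p does not divide k/L, the zeros are those of T_e^d: writing such a zero
   as y = z - z^(p^e) in the closed field, z - z^(p^d) = T_e^d(y) = 0, so z is
   automatically in F_(p^d). The cardinalities are degrees of polynomials whose
   derivative is a nonzero constant. *)

Require Import Defs.
From mathcomp Require Import all_boot all_order all_algebra separable finmap.
From mathcomp Require Import boolp classical_sets functions cardinality.

Set Implicit Arguments.
Unset Strict Implicit.
Unset Printing Implicit Defensive.

Import GRing.Theory.
Local Open Scope classical_set_scope.
Local Open Scope card_scope.
Local Open Scope ring_scope.

(** * Counting roots in a closed field, and elements of finite subfields *)

Lemma card_set_seq (T : choiceType) (s : seq T) :
  uniq s -> [set` s] #= `I_(size s).
Proof.
move=> s_uniq; pose A := [fset x in s]%fset.
have -> : [set` s] = [set` A].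
  by apply/seteqP; split=> x /=; rewrite /A inE.
by apply/card_eq_fsetP; rewrite -(undup_id s_uniq) -card_fseq.
Qed.

Lemma card_eq_seq (T : choiceType) (E : set T) (q : nat) : E #= `I_q ->
  exists s : seq T, [/\ uniq s, size s = q & E = [set` s]].
Proof.
move=> Eq; have Efin : finite_set E by apply/finite_setP; exists q.
exists (finmap.enum_fset (fset_set E)); split; first exact: fset_uniq.
  exact: card_fset_set.
by rewrite -[LHS]fset_setK.
Qed.

(** A nonzero constant derivative is coprime to [P], so the linear factors of [P] over the closed
    field are pairwise distinct. *)
Lemma separable_card_roots (K : closedFieldType) (P : {poly K}) (q : nat) :
  size P^`() = 1%N -> size P = q.+1 ->
  [set x : K | P.[x] = 0] #= `I_q.
Proof.
move=> szdP szP.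
have [s Ps] := closed_field_poly_normal P.
have P_neq0 : P != 0 by rewrite -size_poly_gt0 szP.
have lc_neq0 : lead_coef P != 0 by rewrite lead_coef_eq0.
have szs : size s = q.
  by move: szP; rewrite {1}Ps size_scale // size_prod_XsubC => -[].
have s_uniq : uniq s.
  rewrite -separable_prod_XsubC -(eqp_separable (eqp_scale _ lc_neq0)) -Ps.
  have dP1 : P^`() %= 1 by rewrite -size_poly_eq1 szdP.
  by rewrite unlock (eqp_coprimepr _ dP1) coprimep1.
have -> : [set x : K | P.[x] = 0] = [set` s].
  apply/seteqP; split=> x /=; rewrite -root_prod_XsubC -(rootZ _ _ lc_neq0) -Ps.
    by move/eqP.
  by move/eqP.
by rewrite -szs; apply: card_set_seq.
Qed.

(** As in Fermat's little theorem: for nonzero [x], comparing the product of the nonzero elements of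
    [E] before and after multiplication by [x] gives x^(q-1) = 1. *)
Lemma subfield_order_expr (K : fieldType) (q : nat) (E : set K) (x : K) :
  is_subfield_of_order q E -> E x -> x ^+ q = x.
Proof.
move=> [[E1 EB EV] Eq] Ex.
have [s [s_uniq szs Es]] := card_eq_seq Eq.
have memE y : (y \in mem E) = (y \in s).
  by apply/idP/idP; rewrite inE Es.
have E0 : 0 \in s by rewrite -memE -(subrr 1) EB.
have xs : x \in s by move: Ex; rewrite Es.
(* Since [0 ^+ 0] is 1, the case x = 0 needs q nonzero; this holds because [s] contains 0. *)
have [->|x_neq0] := eqVneq x 0.
  by rewrite expr0n -szs; case: (s) E0.
(* Multiplication by x permutes the nonzero elements t of E. *)
pose t := rem 0 s.
have t_uniq : uniq t by apply: rem_uniq.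
have memt y : (y \in t) = (y != 0) && (y \in s) by rewrite mem_rem_uniq ?inE.
have xVs : x^-1 \in s.
  by rewrite -memE -[x^-1]mul1r EV // memE.
have EM y z : y \in s -> z \in s -> y * z \in s.
  rewrite -!memE => yE zE; rewrite -[z]invrK EV //.
  by rewrite -[z^-1]mul1r EV.
have perm_t : perm_eq [seq x * y | y <- t] t.
  apply: uniq_perm => // [|y].
    by rewrite map_inj_uniq //; apply: mulfI.
  apply/mapP/idP => [[z + ->]|].
    by rewrite !memt mulf_eq0 negb_or x_neq0 => /andP[-> zs]; apply: EM.
  rewrite memt => /andP[y0 ys]; exists (x^-1 * y); last by rewrite mulVKf.
  by rewrite memt mulf_neq0 ?invr_eq0 //= EM.
have prod_neq0 : \prod_(y <- t) y != 0.
  by rewrite prodf_seq_neq0; apply/allP => y; rewrite memt => /andP[].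
have xt : x ^+ size t = 1.
  apply: (mulIf prod_neq0); rewrite mul1r -[RHS](perm_big _ perm_t) /=.
  by rewrite big_map big_split /= big_const_seq count_predT iter_mulr_1.
by rewrite -szs (perm_size (perm_to_rem E0)) /= exprS xt mulr1.
Qed.

(** * Frobenius powers and their fixed fields *)

Section CharP.

Variables (p : nat) (K : closedFieldType).
Hypothesis pcharK : p \in [pchar K].

Let p_prime : prime p := pcharf_prime pcharK.

Let p_nat m : [pchar K].-nat (p ^ m)%N.
Proof. by rewrite pnatX (eq_pnat _ (pcharf_eq pcharK)) pnat_id. Qed.

Lemma expp_gt1 m : (0 < m)%N -> (1 < p ^ m)%N.
Proof. by move=> m_gt0; rewrite -{1}(expn0 p) ltn_exp2l // prime_gt1. Qed.

Lemma exprpD m (x y : K) : (x + y) ^+ (p ^ m) = x ^+ (p ^ m) + y ^+ (p ^ m).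
Proof. exact: exprDn_pchar. Qed.

Lemma exprpB m (x y : K) : (x - y) ^+ (p ^ m) = x ^+ (p ^ m) - y ^+ (p ^ m).
Proof. by rewrite exprpD exprNn_pchar. Qed.

Lemma exprp_sum m (I : Type) (r : seq I) (F : I -> K) :
  (\sum_(i <- r) F i) ^+ (p ^ m) = \sum_(i <- r) F i ^+ (p ^ m).
Proof.
apply: (big_morph (fun x : K => x ^+ (p ^ m)) (exprpD m)).
by rewrite expr0n expn_eq0 (gtn_eqF (prime_gt0 p_prime)).
Qed.

Lemma natr_expp m : (0 < m)%N -> (p ^ m)%:R = 0 :> {poly K}.
Proof.
by case: m => // m _; rewrite expnS natrM -polyC_natr (pcharf0 pcharK) polyC0 mul0r.
Qed.

Lemma deriv_Xnp m : (0 < m)%N -> ('X^(p ^ m) : {poly K})^`() = 0.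
Proof. by move=> m_gt0; rewrite derivXn -mulr_natr natr_expp ?mulr0. Qed.

Lemma exprp_mod (x : K) d m : x ^+ (p ^ d) = x ->
  x ^+ (p ^ m) = x ^+ (p ^ (m %% d)).
Proof.
move=> xd; rewrite {1}(divn_eq m d) expnD exprM; congr (_ ^+ _).
by elim: (m %/ d)%N => [|i IHi]; rewrite ?expr1 // mulSn expnD exprM xd.
Qed.

Lemma exprp_gcdn (x : K) n k : (0 < n)%N ->
  x ^+ (p ^ n) = x -> x ^+ (p ^ k) = x -> x ^+ (p ^ gcdn n k) = x.
Proof.
move=> n_gt0 xn xk; have [a b ab _] := egcdnP k n_gt0.
have := exprp_mod (a * n) xn; rewrite modnMl expr1 ab expnD exprM.
by rewrite (exprp_mod (b * k) xk) modnMl expr1.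
Qed.

Lemma exprp_dvdn (x : K) d n : (d %| n)%N ->
  x ^+ (p ^ d) = x -> x ^+ (p ^ n) = x.
Proof. by move=> /eqP dn /exprp_mod->; rewrite dn expr1. Qed.

Lemma exprp_fixed_card m : (0 < m)%N ->
  [set x : K | x ^+ (p ^ m) = x] #= `I_(p ^ m).
Proof.
move=> m_gt0.
have -> : [set x : K | x ^+ (p ^ m) = x] =
    [set x | ('X^(p ^ m) - 'X : {poly K}).[x] = 0].
  by apply/seteqP; split=> x /=; rewrite !hornerE; [move=> ->; rewrite subrr | move/subr0_eq].
apply: separable_card_roots.
  by rewrite derivB deriv_Xnp // derivX sub0r size_polyN size_poly1.
rewrite size_polyDl size_polyXn // size_polyN size_polyX ltnS.
exact: expp_gt1.
Qed.

(** Replaces the union over subfields by an equation. The fixed points of a Frobenius power form a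
    subfield, and X^(p^m) - X is separable, so that subfield has the right order. *)
Lemma GF_exprE m : (0 < m)%N -> GF K (p ^ m) = [set x | x ^+ (p ^ m) = x].
Proof.
move=> m_gt0; apply/seteqP; split=> [x [E /= EGF Ex]|x xm].
  exact: subfield_order_expr EGF Ex.
exists [set x | x ^+ (p ^ m) = x] => //; split; last exact: exprp_fixed_card.
split=> [|y z|y z]; rewrite !inE /=.
- by rewrite expr1n.
- by rewrite exprpB => -> ->.
- by rewrite exprMn exprVn => -> ->.
Qed.

(** * Values, kernels and degrees of the linearized polynomials *)

Lemma horner_T_poly (R : comNzRingType) u v (x : R) :
  (T_poly R p u v).[x] = \sum_(i < v %/ u) x ^+ (p ^ (u * i)).
Proof. by rewrite horner_sum; apply: eq_bigr => i _; rewrite hornerXn. Qed.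

Lemma horner_S_poly2 (R : comNzRingType) u (x : R) : (0 < u)%N ->
  (S_poly R p u (2 * u)).[x] = x - x ^+ (p ^ u).
Proof.
move=> u_gt0; rewrite /S_poly mulnK // !big_ord_recl big_ord0 /=.
by rewrite !hornerE /= expn0 !expr1 addr0 mulN1r.
Qed.

Lemma T_poly_subX u v (z : K) : (0 < u)%N -> (u %| v)%N ->
  (T_poly K p u v).[z - z ^+ (p ^ u)] = z - z ^+ (p ^ v).
Proof.
move=> u_gt0 uv; rewrite horner_T_poly.
rewrite -(big_mkord xpredT (fun i => (z - z ^+ (p ^ u)) ^+ (p ^ (u * i)))).
(* The i-th term becomes z^(p^(ui)) - z^(p^(u(i+1))), and the sum telescopes. *)
under eq_bigr => i _ do rewrite exprpB -exprM -expnD -mulnS -opprB.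
rewrite sumrN telescope_sumr // opprB muln0 expr1 mulnC.
by rewrite divnK.
Qed.

Lemma T_poly_eq0_expr u v (x : K) : (0 < u)%N -> (u %| v)%N ->
  (T_poly K p u v).[x] = 0 -> x ^+ (p ^ v) = x.
Proof.
move=> u_gt0 uv Tx; apply/esym/eqP; rewrite -subr_eq0 -(T_poly_subX x u_gt0 uv).
(* T commutes with Frobenius, so its value at x - x^(p^u) is T(x) - T(x)^(p^u), which vanishes with
   T(x). *)
rewrite horner_T_poly; under eq_bigr => i _ do
  rewrite exprpB (exprAC _ (p ^ u)).
by rewrite sumrB -exprp_sum -horner_T_poly Tx sub0r expr0n expn_eq0
  (gtn_eqF (prime_gt0 p_prime)) oppr0.
Qed.

Lemma T_poly_kernel e d : (0 < e)%N -> (e %| d)%N ->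
  [set x : K | (T_poly K p e d).[x] = 0] =
  [set (S_poly K p e (2 * e)).[x] | x in [set x : K | x ^+ (p ^ d) = x]].
Proof.
move=> e_gt0 ed; apply/seteqP; split=> [y /= Ty|_ [z /= zd <-]] /=; last first.
  by rewrite horner_S_poly2 // T_poly_subX // zd subrr.
(* A root solves z - z^(p^e) = y; as p^e > 1, the leading term is X^(p^e) and the polynomial is not
   constant. *)
have [z] : exists z, root ('X^(p ^ e) - ('X - y%:P)) z.
  apply/closed_rootP; rewrite size_polyDl size_polyXn.
    by rewrite eqSS expn_eq0 (gtn_eqF (prime_gt0 p_prime)).
  by rewrite size_polyN size_XsubC ltnS; apply: expp_gt1.
rewrite /root !hornerE subr_eq0 => /eqP zy.
have {}zy : z - z ^+ (p ^ e) = y by rewrite zy subKr.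
exists z; last by rewrite horner_S_poly2.
by apply/esym/eqP; rewrite -subr_eq0 -(T_poly_subX _ e_gt0 ed) zy Ty.
Qed.

Lemma size_sum_Xnp e m : (0 < e)%N ->
  size (\sum_(i < m.+1) 'X^(p ^ (e * i)) : {poly K}) = (p ^ (e * m)).+1.
Proof.
move=> e_gt0; elim: m => [|m IHm].
  by rewrite big_ord1 size_polyXn.
rewrite big_ord_recr /= addrC size_polyDl size_polyXn // IHm ltnS.
by rewrite ltn_exp2l ?prime_gt1 // ltn_pmul2l.
Qed.

Lemma T_poly_card e d : (0 < e)%N -> (0 < d)%N -> (e %| d)%N ->
  [set x : K | (T_poly K p e d).[x] = 0] #= `I_(p ^ (d - e)).
Proof.
(* With d = (m+1)e the top exponent is p^(em) = p^(d-e). Only the term i = 0, which is X, has a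
   nonzero derivative. *)
move=> e_gt0 d_gt0 /dvdnP[[|m] dE]; first by rewrite dE in d_gt0.
have -> : (d - e = e * m)%N by rewrite dE mulSn addKn mulnC.
rewrite /T_poly dE mulnK //; apply: separable_card_roots; last exact: size_sum_Xnp.
rewrite big_ord_recl muln0 derivD derivX raddf_sum /=.
by rewrite big1 ?addr0 ?size_poly1 // => i _; rewrite deriv_Xnp // muln_gt0 e_gt0.
Qed.

(** * Reindexing sums over residues, and the reduction to a trace *)

Lemma sum_coprime_mod (V : nmodType) (a m : nat) (F : nat -> V) : (0 < m)%N ->
  coprime a m -> \sum_(i < m) F (a * i %% m)%N = \sum_(i < m) F i.
Proof.
move=> m_gt0 am; pose h (i : 'I_m) := Ordinal (ltn_pmod (a * i) m_gt0).
have h_inj : injective h.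
  move=> i j /(congr1 val) /= /eqP; wlog ij : i j / (i <= j)%N => [wl|].
    by case/orP: (leq_total i j) => [/wl//|/wl ji]; rewrite eq_sym => /ji->.
  (* m divides a(j - i), hence j - i, which is smaller than m and so must be 0. *)
  rewrite eq_sym eqn_mod_dvd ?leq_mul // -mulnBr Gauss_dvdr; last by rewrite coprime_sym.
  move=> /dvdn_leq; rewrite subn_gt0 => dv; apply/val_inj/eqP.
  rewrite eqn_leq ij leqNgt; apply/negP => /dv.
  by rewrite leqNgt (leq_ltn_trans (leq_subr i j)).
by rewrite [RHS](reindex_inj h_inj).
Qed.

Lemma sum_periodic (V : nmodType) (m q : nat) (F : nat -> V) :
  (forall i, F (m + i)%N = F i) ->
  \sum_(i < q * m) F i = (\sum_(i < m) F i) *+ q.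
Proof.
move=> Fm; elim: q => [|q IHq]; first by rewrite mul0n big_ord0.
by rewrite mulSn big_split_ord /= mulrS -IHq; under [X in _ + X]eq_bigr do rewrite Fm.
Qed.

Lemma horner_T_poly_trace d l k (x : K) : (0 < d)%N -> (0 < l)%N ->
  (l %| k)%N -> (d %| k)%N -> x ^+ (p ^ d) = x ->
  (T_poly K p l k).[x] = (T_poly K p (gcdn d l) d).[x] *+ (k %/ lcmn d l).
Proof.
move=> d_gt0 l_gt0 lk dk xd; set e := gcdn d l.
have e_gt0 : (0 < e)%N by rewrite gcdn_gt0 d_gt0.
have [a la] := dvdnP (dvdn_gcdr d l : e %| l)%N.
have [m dm] := dvdnP (dvdn_gcdl d l : e %| d)%N.
have m_gt0 : (0 < m)%N by move: d_gt0; rewrite dm muln_gt0 => /andP[].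
have am : coprime a m.
  rewrite /coprime -(eqn_pmul2r e_gt0) mul1n muln_gcdl -la -dm gcdnC.
  by rewrite eqxx.
have L : lcmn d l = (l * m)%N.
  by apply/eqP; rewrite -(eqn_pmul2r e_gt0) muln_lcm_gcd {1}dm mulnC mulnA.
have Lk : (lcmn d l %| k)%N by rewrite dvdn_lcm dk.
have kl : (k %/ l = k %/ lcmn d l * m)%N.
  by rewrite -{1}(divnK Lk) L mulnCA mulKn.
rewrite !horner_T_poly kl.
(* The k/l terms form k/L blocks of length m: the summand has period m because l m = L is a multiple
   of d. *)
rewrite (@sum_periodic K m _ (fun i => x ^+ (p ^ (l * i)))) => [|i]; last first.
  by rewrite mulnDr expnD exprM (exprp_dvdn _ xd) // -L dvdn_lcml.
congr (_ *+ _); have -> : (d %/ e = m)%N by rewrite dm mulnK.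
rewrite -(sum_coprime_mod (fun i => x ^+ (p ^ (e * i))) m_gt0 am).
(* With l = ae and d = me, the exponents l i and e(a i mod m) agree modulo d. *)
apply: eq_bigr => i _; rewrite (exprp_mod (l * i) xd) [RHS](exprp_mod _ xd).
by rewrite dm la (mulnC m) muln_modr modn_mod mulnA (mulnC a).
Qed.

End CharP.

Theorem theorem1 (p : nat) (p_prime : prime p)
    (K : closedFieldType) (iota : {rmorphism 'F_p -> K})
    (K_closure : is_algebraic_closure iota)
    (n k l : nat) (n_gt0 : (0 < n)%N) (k_gt0 : (0 < k)%N) (l_gt0 : (0 < l)%N)
    (l_dvd_k : (l %| k)%N) :
  let d := gcdn n k in
  let e := gcdn n l in
  let L := lcmn d l in
  let Z := [set x : K | GF K (p ^ n)%N x /\ (T_poly K p l k).[x] = 0] in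
  Z = (if (p %| k %/ L)%N then GF K (p ^ d)%N
       else [set (S_poly K p e (2 * e)%N).[x] | x in GF K (p ^ d)%N])
  /\ Z #= `I_(if (p %| k %/ L)%N then p ^ d else p ^ (d - e))%N.
Proof.
move=> d e L Z.
have pcharK : p \in [pchar K] by apply: (rmorph_pchar iota); apply: pchar_Fp.
have d_gt0 : (0 < d)%N by rewrite gcdn_gt0 n_gt0.
have e_gt0 : (0 < e)%N by rewrite gcdn_gt0 n_gt0.
(* Since gcd(k, l) = l, the e of the statement is the one produced by the trace reduction. *)
have eE : e = gcdn d l by rewrite -gcdnA (gcdn_idPr l_dvd_k).
have ed : (e %| d)%N by rewrite eE dvdn_gcdl.
have ZE : Z = [set x | x ^+ (p ^ d) = x /\ (T_poly K p e d).[x] *+ (k %/ L) = 0].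
  rewrite /Z GF_exprE //; apply/seteqP; split=> x /= [xn Tx].
    have xd : x ^+ (p ^ d) = x.
      by apply: exprp_gcdn => //; apply: T_poly_eq0_expr Tx.
    by rewrite eE -horner_T_poly_trace ?dvdn_gcdr.
  split; first by apply: exprp_dvdn xn; rewrite dvdn_gcdl.
  by rewrite (horner_T_poly_trace d_gt0) ?dvdn_gcdr // -eE.
(* In characteristic p, divisibility of k/L by p means that the scalar k/L is zero in [K]. *)
rewrite ZE GF_exprE //; case: ifPn; rewrite (dvdn_pcharf pcharK) => kL.
  have -> : [set x | x ^+ (p ^ d) = x /\ (T_poly K p e d).[x] *+ (k %/ L) = 0]
      = [set x | x ^+ (p ^ d) = x].
    apply/seteqP; split=> x /= [] // xd.
    by rewrite -mulr_natr (eqP kL) mulr0.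
  by split=> //; apply: exprp_fixed_card.
have -> : [set x | x ^+ (p ^ d) = x /\ (T_poly K p e d).[x] *+ (k %/ L) = 0]
    = [set x | (T_poly K p e d).[x] = 0].
  apply/seteqP; split=> x /= [].
    by move=> _ /eqP; rewrite -mulr_natr mulf_eq0 (negPf kL) orbF => /eqP.
  move=> Tx; split; first exact: T_poly_eq0_expr Tx.
  by rewrite Tx mul0rn.
by split; [apply: T_poly_kernel | apply: T_poly_card].
Qed.
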